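(* Let $N\ge 1$ and let $I\subseteq R=\mathbb{C}[x_0,\ldots,x_N]$ be the radical ideal of a (nonempty) finite set of points in $\mathbb{P}^N_{\mathbb{C}}$. Then for every positive integer $t\geq N-1$ and every $m\geq 1$ $$\frac{\alpha\big((I^{(t)})^{(m)}\big)}{m}\geq \frac{\alpha(I^{(t)})+N-1}{N}.$$
   Context: The radical ideal of a finite set $X$ of points is the ideal generated by all homogeneous polynomials vanishing on $X$. For a homogeneous ideal $I$ of $R$: $\alpha(I)$ is the least degree of a nonzero homogeneous polynomial in $I$; $I^{(m)}=\bigcap_{p\in\mathrm{Ass}(R/I)}(I^mR_p\cap R)$. *)

(* Defs.v *)
From HB Require Import structures.
From mathcomp Require Export all_boot all_order all_algebra.
From mathcomp Require Export finmap.
From mathcomp Require Export mpoly.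
From mathcomp Require Export boolp classical_sets reals complex.
#[export] Set Implicit Arguments.
#[export] Unset Strict Implicit.
#[export] Unset Printing Implicit Defensive.
Import Order.TTheory GRing.Theory Num.Theory.

Local Open Scope ring_scope.
Local Open Scope classical_set_scope.

Definition ideal_gen (A : comNzRingType) (S : set A) : set A :=
  [set f | exists (k : nat) (c a : 'I_k -> A),
    (forall i, S (a i)) /\ f = \sum_(i < k) c i * a i].

(* [ideal_pow J 0] is the unit ideal. *)
Definition ideal_pow (A : comNzRingType) (J : set A) (m : nat) : set A :=
  ideal_gen [set f | exists a : 'I_m -> A,
    (forall i, J (a i)) /\ f = \prod_(i < m) a i].

(* MathComp's [idealr_closed] already contains properness (1 is not in P). *)
Definition prime_ideal (A : comNzRingType) (P : set A) : Prop :=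
  idealr_closed [pred f | f \in P] /\ prime_idealr_closed [pred f | f \in P].

(* Ass(A/J): the primes of the form (J : f), the annihilator of the class
   of f in A/J. *)
Definition Ass (A : comNzRingType) (J : set A) : set (set A) :=
  [set P | prime_ideal P /\ exists f : A, P = [set g | J (g * f)]].

(* For a domain A, the localization A_P is realized inside Frac(A). *)
Definition localization (A : idomainType) (P : set A) : set {fraction A} :=
  [set z | exists a s : A, ~ P s /\ z = tofrac a / tofrac s].

(* The extended ideal J A_P, generated over A_P by the image of J. *)
Definition local_extension (A : idomainType) (P J : set A) :
    set {fraction A} :=
  [set z | exists (k : nat) (c : 'I_k -> {fraction A}) (a : 'I_k -> A),
    [/\ forall i, localization P (c i), forall i, J (a i)
      & z = \sum_(i < k) c i * tofrac (a i)]].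

Definition symbolic_power (A : idomainType) (J : set A) (m : nat) : set A :=
  [set f | forall P, Ass J P -> local_extension P (ideal_pow J m) (tofrac f)].

Definition has_form_of_degree (K : fieldType) (n : nat)
    (J : set {mpoly K[n]}) (d : nat) : Prop :=
  exists f : {mpoly K[n]}, [/\ f != 0, f \is d.-homog & J f].

(* The default value 0 is taken only when J contains no nonzero form. *)
Definition alpha (K : fieldType) (n : nat) (J : set {mpoly K[n]}) : nat :=
  xget 0%N [set d | has_form_of_degree J d /\
                    forall e, has_form_of_degree J e -> (d <= e)%N].

(* Points of P^N are the lines through the origin of K^(N+1). *)
Definition proj_space (K : fieldType) (N : nat) : choiceType :=
  {L : {vspace 'rV[K]_N.+1} | \dim L == 1%N}.

(* For homogeneous f this is f(v) = 0 for one (equivalently, every) nonzero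
   representative v of the point: a nonzero constant form takes a nonzero value
   everywhere, and a form of positive degree is 0 at the origin. *)
Definition vanishes_at (K : fieldType) (N : nat) (f : {mpoly K[N.+1]})
    (x : proj_space K N) : Prop :=
  forall v : 'rV[K]_N.+1, v \in val x -> f.@[v ord0] = 0.

Definition radical_ideal (K : fieldType) (N : nat)
    (X : {fset proj_space K N}) : set {mpoly K[N.+1]} :=
  ideal_gen [set f | (exists d : nat, f \is d.-homog) /\
                     forall x, x \in X -> vanishes_at f x].

(* Main.v *)
(* Let [J_s] be the ideal of the polynomials vanishing to order [s] along the
   lines of [X]. Then [I = J_1], [I^(t) = J_t] and [(J_t)^(m)] is contained in
   [J_(tm)], so it suffices to show that a form of degree [d] in [J_s] satisfies
   [d / s >= (alpha(J_t) + e) / (t + N - 1)], where [e = 1] if [N >= 2] and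
   [e = 0] if [N = 1]; the case [s = t m] and [t >= N - 1] give the claim.

   The linear system defining the polynomials of degree less than [alpha(J_t)]
   in [J_t] having only the zero solution, the points and the given form specialize to an
   algebraically closed field of arbitrarily large characteristic [p], keeping
   this property. There, a power [f] of the form lies in [J_(p (t + N - 1))], and
   by the pigeonhole principle on exponents, [f] is at each point in the ideal
   generated by the [p]-th powers of the elements vanishing to order [t].
   Derivations preserve this ideal. Differentiating [f] until all the derivatives
   vanish therefore gives the [p]-th power of an element of [J_t], whence
   [deg f >= p alpha(J_t)]; the gain [e] comes from one more differentiation. *)
From HB Require Import structures.
Require Import Defs.
From mathcomp Require Import closed_field zify ring.
Import Order.TTheory GRing.Theory Num.Theory.
Local Open Scope ring_scope.

(** * Order of vanishing along a line *)

Lemma coef_deg1 (R : nzRingType) (a b : R) j :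
  (a%:P * 'X + b%:P)`_j = match j with 0%N => b | 1%N => a | _ => 0 end.
Proof. by rewrite coefD coefMX !coefC; case: j => [|[|j]]; rewrite ?add0r ?addr0. Qed.

Section Dilation.
Context (A : comNzRingType) (n : nat).
Implicit Types (x : 'I_n * ('I_n -> A)) (f g h : {mpoly A[n]}) (m : 'X_{1..n}).

(* A pair [x = (k, v)] stands for the line spanned by [v], normalized by
   [v k = 1]; the entry [v k] is never read. In the coordinates [X_k] and
   [X_i - v_i X_k] ([i != k]), of which the latter cut out the line, the
   dilation multiplies the latter by the parameter ['X] of [{poly _}] and fixes
   [X_k]. The order of vanishing along the line is thus the ['X]-adic order. *)
Definition dilation_gen x (i : 'I_n) : {poly {mpoly A[n]}} :=
  if i == x.1 then ('X_i)%:P else ('X_i)%:P * 'X + (x.2 i *: 'X_(x.1))%:P.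

Fact dilation_key : unit. Proof. exact: tt. Qed.

Definition dilation x : {mpoly A[n]} -> {poly {mpoly A[n]}} :=
  locked_with dilation_key (mmap (polyC \o @mpolyC n A) (dilation_gen x)).

Lemma dilation_mmap x : dilation x = mmap (polyC \o @mpolyC n A) (dilation_gen x).
Proof. exact: unlock. Qed.

Fact dilation_is_additive x : additive (dilation x).
Proof. by rewrite dilation_mmap; apply: rmorphB. Qed.

Fact dilation_is_multiplicative x : multiplicative (dilation x).
Proof. by rewrite dilation_mmap; split; [apply: rmorphM | apply: rmorph1]. Qed.

HB.instance Definition _ x :=
  GRing.isAdditive.Build {mpoly A[n]} {poly {mpoly A[n]}} (dilation x) (dilation_is_additive x).
HB.instance Definition _ x :=
  GRing.isMultiplicative.Build {mpoly A[n]} {poly {mpoly A[n]}} (dilation x)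
    (dilation_is_multiplicative x).

Lemma dilationZ x c f : dilation x (c *: f) = c%:MP%:P * dilation x f.
Proof. by rewrite dilation_mmap mmapZ. Qed.

Lemma dilationXU x i : dilation x 'X_i = dilation_gen x i.
Proof. by rewrite dilation_mmap mmapX mmap1U. Qed.

Lemma dilationX x m : dilation x 'X_[m] = \prod_i dilation_gen x i ^+ m i.
Proof. by rewrite dilation_mmap mmapX. Qed.

Definition ord_ge x s f := forall j, (j < s)%N -> (dilation x f)`_j = 0.

Lemma coef0_mulXn (R : nzRingType) (p : {poly R}) s :
  (forall j, (j < s)%N -> p`_j = 0) <-> exists q, p = q * 'X^s.
Proof.
split=> [p0|[q ->] j js]; last by rewrite coefMXn js.
exists (drop_poly s p); rewrite -[LHS](poly_take_drop s) [take_poly s p](_ : _ = 0) ?add0r //.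
by apply/polyP => j; rewrite coef_take_poly coef0; case: ltnP => // /p0.
Qed.

Lemma ord_geP x s f : ord_ge x s f <-> exists q, dilation x f = q * 'X^s.
Proof. exact: coef0_mulXn. Qed.

Lemma ord_ge_leq x s s' f : (s' <= s)%N -> ord_ge x s f -> ord_ge x s' f.
Proof. by move=> ss' sf j js; apply/sf/(leq_trans js). Qed.

Lemma ord_ge0n x f : ord_ge x 0 f. Proof. by []. Qed.

Lemma ord_ge0 x s : ord_ge x s 0.
Proof. by move=> j _; rewrite rmorph0 coef0. Qed.

Lemma ord_geD x s f g : ord_ge x s f -> ord_ge x s g -> ord_ge x s (f + g).
Proof. by move=> sf sg j js; rewrite rmorphD coefD sf ?sg ?addr0. Qed.

Lemma ord_geM x s s' f g :
  ord_ge x s f -> ord_ge x s' g -> ord_ge x (s + s') (f * g).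
Proof.
move=> /ord_geP[p pE] /ord_geP[q qE]; apply/ord_geP; exists (p * q).
by rewrite rmorphM /= pE qE exprD mulrACA.
Qed.

Lemma ord_geMl x s f g : ord_ge x s f -> ord_ge x s (g * f).
Proof. by move=> sf; apply: (ord_geM (ord_ge0n x g) sf). Qed.

Lemma ord_geMr x s f g : ord_ge x s f -> ord_ge x s (f * g).
Proof. by rewrite mulrC; apply: ord_geMl. Qed.

Lemma ord_geZ x s c f : ord_ge x s f -> ord_ge x s (c *: f).
Proof. by rewrite -mul_mpolyC; apply: ord_geMl. Qed.

Lemma ord_ge_exp x s k f : ord_ge x s f -> ord_ge x (s * k) (f ^+ k).
Proof.
move=> sf; elim: k => [|k IH]; first by rewrite muln0.
by rewrite exprS mulnS; apply: ord_geM.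
Qed.

Definition line_coord x i : {mpoly A[n]} :=
  if i == x.1 then 'X_i else 'X_i - x.2 i *: 'X_(x.1).

Lemma dilation_line_coord x i : dilation x (line_coord x i) =
  if i == x.1 then ('X_i)%:P else ('X_i)%:P * 'X.
Proof.
rewrite /line_coord; case: (eqVneq i x.1) => ix; first by rewrite dilationXU /dilation_gen ix eqxx.
rewrite rmorphB /= dilationZ !dilationXU /dilation_gen (negPf ix) eqxx -mul_mpolyC.
by rewrite [X in _ + X - _]polyCM addrK.
Qed.

Lemma ord_ge_line_coord x i : ord_ge x (i != x.1) (line_coord x i).
Proof.
case: eqVneq => ix; first exact: ord_ge0n.
by apply/ord_geP; exists ('X_i)%:P; rewrite dilation_line_coord (negPf ix) expr1.
Qed.

Lemma ord_ge1_line_coord x i : i != x.1 -> ord_ge x 1 (line_coord x i).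
Proof. by move=> ix; have := @ord_ge_line_coord x i; rewrite ix. Qed.

Definition line_monomial x m : {mpoly A[n]} := \prod_i line_coord x i ^+ m i.

(** With [k] the pivot of the line, this is the order of vanishing of [line_monomial x m]: every
    line coordinate but the pivot has order one. *)
Definition wt (k : 'I_n) m := (\sum_(i | i != k) m i)%N.

Lemma wtD k m m' : wt k (m + m')%MM = (wt k m + wt k m')%N.
Proof. by rewrite /wt -big_split; apply: eq_bigr => i _; rewrite mnmDE. Qed.

Lemma wtU k i : wt k U_(i)%MM = (i != k).
Proof.
rewrite /wt; case: eqVneq => [->|ik].
  by rewrite big1 // => j jk; rewrite mnm1E eq_sym (negPf jk).
rewrite (bigD1 i) //= mnm1E eqxx big1 // => j /andP[_ ji].
by rewrite mnm1E eq_sym (negPf ji).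
Qed.

Lemma wt0 k : wt k 0%MM = 0%N.
Proof. by rewrite /wt big1 // => i _; rewrite mnm0E. Qed.

(** The parameter ['X] only enters together with some ['X_i], [i != k]. In a dilated monomial its
    exponent is therefore the weight, while the total degree is preserved. *)
Definition bihomog (k : 'I_n) (d : nat) (p : {poly {mpoly A[n]}}) :=
  forall j m, p`_j@_m != 0 -> wt k m = j /\ mdeg m = d.

Lemma bihomogM k d d' (g g' : {poly {mpoly A[n]}}) :
  bihomog k d g -> bihomog k d' g' -> bihomog k (d + d') (g * g').
Proof.
move=> hg hg' j m; rewrite coefM raddf_sum /= => nz.
have [i nzi] : exists i : 'I_j.+1, (g`_i * g'`_(j - i))@_m != 0.
  apply: contrapT => no; move/negP: nz; apply; apply/eqP/big1 => i _.
  by apply/eqP/negPn/negP => ?; apply: no; exists i.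
move: nzi; rewrite -mcoeff_msupp => /msuppM_le /allpairsP[[m1 m2] /=].
rewrite !mcoeff_msupp => -[m1g m2g ->]; have [w1 <-] := hg _ _ m1g.
have [w2 <-] := hg' _ _ m2g; rewrite wtD w1 w2 mdegD; split=> //.
by rewrite subnKC // -ltnS.
Qed.

Lemma bihomog1 k : bihomog k 0 1.
Proof.
move=> j m; rewrite coef1; case: (j =P 0%N) => [->|_]; last by rewrite mcoeff0 eqxx.
by rewrite mcoeff1; case: (m =P 0%MM) => [->|_]; rewrite ?eqxx // wt0 mdeg0.
Qed.

Lemma bihomog_gen x i : bihomog x.1 1 (dilation_gen x i).
Proof.
rewrite /dilation_gen => j m; case: (eqVneq i x.1) => ix.
  rewrite coefC; case: (j =P 0%N) => [->|_]; last by rewrite mcoeff0 eqxx.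
  rewrite mcoeffX; case: (U_(i)%MM =P m) => [<-|_]; last by rewrite eqxx.
  by rewrite wtU mdeg1 ix eqxx.
rewrite coef_deg1; case: j => [|[|j]]; last by rewrite mcoeff0 eqxx.
  rewrite mcoeffZ mcoeffX; case: (U_(x.1)%MM =P m) => [<-|_]; last by rewrite mulr0 eqxx.
  by rewrite wtU mdeg1 eqxx.
rewrite mcoeffX; case: (U_(i)%MM =P m) => [<-|_]; last by rewrite eqxx.
by rewrite wtU mdeg1 ix.
Qed.

Lemma bihomog_dilationX x m : bihomog x.1 (mdeg m) (dilation x 'X_[m]).
Proof.
rewrite dilationX mdegE; elim/big_ind2: _.
- exact: bihomog1.
- by move=> d1 g1 d2 g2; apply: bihomogM.
- move=> i _; elim: (m i) => [|k IH]; first by rewrite expr0; apply: bihomog1.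
  by rewrite exprS -add1n; apply: bihomogM => //; apply: bihomog_gen.
Qed.

Lemma dilationE x f : dilation x f = \sum_(m <- msupp f) (f@_m)%:MP%:P * dilation x 'X_[m].
Proof. by rewrite {1}(mpolyE f) raddf_sum /=; apply: eq_bigr => m _; rewrite dilationZ. Qed.

Lemma coef_dilationE x f j m : (dilation x f)`_j@_m =
  \sum_(a <- msupp f) f@_a * (dilation x 'X_[a])`_j@_m.
Proof.
rewrite dilationE coef_sum raddf_sum /=; apply: eq_bigr => a _.
by rewrite coefCM mul_mpolyC mcoeffZ.
Qed.

Lemma coef_dilation_neq0 x f j m : (dilation x f)`_j@_m != 0 ->
  exists2 a, a \in msupp f & wt x.1 m = j /\ mdeg m = mdeg a.
Proof.
rewrite coef_dilationE => nz; apply: contrapT => no; move/negP: nz; apply; apply/eqP.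
rewrite big_seq; apply: big1 => a af; case: (eqVneq (dilation x 'X_[a])`_j@_m 0) => [->|].
  by rewrite mulr0.
by move=> /(@bihomog_dilationX _ _ _ _) wd; case: no; exists a.
Qed.

Lemma dilation_homog x f d j : f \is d.-homog -> (dilation x f)`_j \is d.-homog.
Proof.
move=> /dhomogP fd; apply/dhomogP => m; rewrite mcoeff_msupp.
by move=> /coef_dilation_neq0[a /fd <- []].
Qed.

(** At parameter 1 the dilation substitutes [X_i + v_i X_k] for [X_i], [i != k], and the line
    coordinates invert this. *)
Lemma dilation_undo x f : f = ((dilation x f).[1]) \mPo [tuple line_coord x i | i < n].
Proof.
have gen i : ((dilation_gen x i).[1]) \mPo [tuple line_coord x i | i < n] = 'X_i.
  rewrite /dilation_gen /line_coord; case: eqVneq => ix.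
    by rewrite hornerC comp_mpolyXU -tnth_nth tnth_mktuple ix eqxx.
  rewrite !hornerE /= rmorphD /= comp_mpolyZ !comp_mpolyXU -!tnth_nth !tnth_mktuple.
  by rewrite (negPf ix) eqxx subrK.
rewrite {1}(mpolyE f) dilationE horner_sum raddf_sum /=; apply: eq_bigr => m _.
rewrite hornerM hornerC rmorphM /= comp_mpolyC mul_mpolyC; congr (_ *: _).
rewrite dilationX horner_prod rmorph_prod /= mpolyXE_id; apply: eq_bigr => i _.
by rewrite hornerE /= rmorphXn /= gen.
Qed.

Lemma dilation_expand x f : f =
  \sum_(j < size (dilation x f))
    \sum_(m <- msupp (dilation x f)`_j) (dilation x f)`_j@_m *: line_monomial x m.
Proof.
rewrite {1}(dilation_undo x f) horner_coef raddf_sum /=; apply: eq_bigr => j _.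
rewrite expr1n mulr1 comp_mpolyEX; apply: eq_bigr => m _; congr (_ *: _).
by rewrite comp_mpolyX; apply: eq_bigr => i _; rewrite tnth_mktuple.
Qed.

(** In the expansion of [f] in line coordinates, the weights that occur are the exponents of the
    parameter in the dilation, so only line monomials of weight at least [s] remain. *)
Lemma ord_ge_ind x s (P : {mpoly A[n]} -> Prop) : P 0 ->
  (forall f g, P f -> P g -> P (f + g)) ->
  (forall c m, (s <= wt x.1 m)%N -> P (c *: line_monomial x m)) ->
  forall f, ord_ge x s f -> P f.
Proof.
move=> P0 PD PX f sf; rewrite (dilation_expand x f); apply: big_ind => // j _.
have [js|sj] := ltnP j s; first by rewrite sf // msupp0 big_nil.
rewrite big_seq; apply: big_ind => // m; rewrite mcoeff_msupp => mj.
by apply: PX; case: (coef_dilation_neq0 mj) => a _ [-> _].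
Qed.

(** The dilation preserves degree, so the contributions of different homogeneous components of [f]
    to a coefficient cannot cancel. *)
Lemma ord_ge_pihomog x s f d : ord_ge x s f -> ord_ge x s (pihomog mdeg d f).
Proof.
move=> sf j js; have := congr1 (pihomog mdeg d) (sf j js).
rewrite {1}(pihomog_partitionE (leqnn (msize f))) rmorph_sum coef_sum /=.
rewrite raddf_sum pihomog0 /= => S0; have [dn|nd] := ltnP d (msize f).
  move: S0; rewrite (bigD1 (Ordinal dn)) //= pihomog_dE; last exact/dilation_homog/pihomogP.
  rewrite big1 ?addr0 // => e ed; rewrite (@pihomog_ne0 _ _ _ e d) //.
  exact/dilation_homog/pihomogP.
rewrite (_ : pihomog _ _ _ = 0) ?rmorph0 ?coef0 //.
rewrite pihomogE big1_seq // => m /andP[/= /eqP md /msize_mdeg_lt].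
by rewrite md ltnNge nd.
Qed.

Lemma ord_ge_mderiv x s f i : ord_ge x s f -> ord_ge x s.-1 (f^`M(i)).
Proof.
(* The Leibniz rule makes [W] multiplicative, so it passes from the line coordinates to the line
   monomials. *)
pose W s f := ord_ge x s f /\ forall i, ord_ge x s.-1 (f^`M(i)).
have WM a b g h : W a g -> W b h -> W (a + b)%N (g * h).
  move=> [ga g'] [hb h']; split=> [|l]; first exact: ord_geM.
  rewrite mderivM; apply: ord_geD.
    by apply: (ord_ge_leq _ (ord_geM (g' l) hb)); lia.
  by apply: (ord_ge_leq _ (ord_geM ga (h' l))); lia.
have W1 : W 0%N 1 by [].
have WX m : W (wt x.1 m) (line_monomial x m).
  have -> : wt x.1 m = (\sum_i (m i * (i != x.1)))%N.
    by rewrite /wt big_mkcond; apply: eq_bigr => l _; case: eqP; rewrite ?muln0 ?muln1.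
  rewrite /line_monomial; elim/big_ind2: _ => // [a g b h|l _]; first exact: WM.
  elim: (m l) => [|k IH] //.
  rewrite exprS mulSn; apply: WM => //; split; first exact: ord_ge_line_coord.
  by move=> l'; case: (l != x.1).
move: f; apply: (ord_ge_ind (x := x)) => [|f g|c m sm].
- by rewrite mderiv0; apply: ord_ge0.
- by rewrite mderivD; apply: ord_geD.
- rewrite mderivZ; apply: ord_geZ; have [_ /(_ i)] := WX m.
  by apply: ord_ge_leq; lia.
Qed.

End Dilation.

Section DilationDomain.
Context (K : idomainType) (n : nat).
Implicit Types (x : 'I_n * ('I_n -> K)) (f g h : {mpoly K[n]}).

Lemma poly_Xfactor (D : idomainType) (p : {poly D}) : p != 0 ->
  exists a q, p = q * 'X^a /\ q`_0 != 0.
Proof.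
move=> p0; have ex : exists j, p`_j != 0 by exists (size p).-1; rewrite -lead_coefE lead_coef_eq0.
have [a pa mina] := ex_minnP ex.
have [|q pq] := (coef0_mulXn p a).1.
  by move=> j ja; apply/eqP/negPn/negP => /mina; rewrite leqNgt ja.
by exists a, q; split=> //; move: pa; rewrite pq coefMXn ltnn subnn.
Qed.

Lemma dilation_inj x : injective (dilation x).
Proof. by move=> f g fg; rewrite (dilation_undo x f) (dilation_undo x g) fg. Qed.

Lemma dilation_eq0 x f : (dilation x f == 0) = (f == 0).
Proof. by rewrite -(inj_eq (@dilation_inj x)) rmorph0. Qed.

Lemma ord_ge_factor x f a q s : dilation x f = q * 'X^a -> q`_0 != 0 ->
  ord_ge x s f <-> (s <= a)%N.
Proof.
move=> fE q0; split=> [sf|sa].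
  by rewrite leqNgt; apply/negP => /sf /eqP; rewrite fE coefMXn ltnn subnn; apply/negP.
by move=> j js; rewrite fE coefMXn (leq_trans js sa).
Qed.

Lemma ord_geM_cancel x a b f g :
  ord_ge x (a + b) (f * g) -> ~ ord_ge x b.+1 g -> ord_ge x a f.
Proof.
have [->|f0] := eqVneq f 0; first by move=> *; apply: ord_ge0.
have [->|g0] := eqVneq g 0; first by move=> _ []; apply: ord_ge0.
move: f0 g0; rewrite -2!(dilation_eq0 x) => /poly_Xfactor[c [p [fE p0]]].
move=> /poly_Xfactor[d [q [gE q0]]].
have fgE : dilation x (f * g) = (p * q) * 'X^(c + d) by rewrite rmorphM /= fE gE exprD mulrACA.
rewrite (ord_ge_factor _ fgE) ?coef0M ?mulf_neq0 //.
rewrite (ord_ge_factor _ gE q0) (ord_ge_factor _ fE p0) => abcd /negP bd.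
by lia.
Qed.

Lemma ord_ge_expK x s p f : (0 < p)%N ->
  ord_ge x (s * p).+1 (f ^+ p) -> ord_ge x s.+1 f.
Proof.
move=> p0; have [->|] := eqVneq f 0; first by move=> *; apply: ord_ge0.
rewrite -(dilation_eq0 x) => /poly_Xfactor[a [q [fE q0]]].
have fpE : dilation x (f ^+ p) = q ^+ p * 'X^(a * p).
  by rewrite rmorphXn /= fE exprMn -exprM.
have qp0 : (q ^+ p)`_0 != 0 by rewrite -horner_coef0 horner_exp expf_neq0 // horner_coef0.
by rewrite (ord_ge_factor _ fpE qp0) (ord_ge_factor _ fE q0) ltn_pmul2r.
Qed.

End DilationDomain.

(** * The degree bound in positive characteristic *)

Section IteratedDerivatives.
Context (K : idomainType) (n : nat).
Implicit Types (x : 'I_n * ('I_n -> K)) (f g h : {mpoly K[n]}) (s : seq 'I_n).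

Definition derivs s f := foldr (fun i g => g^`M(i)) f s.

Lemma derivsD s f g : derivs s (f + g) = derivs s f + derivs s g.
Proof. by elim: s => //= i s ->; rewrite mderivD. Qed.

Lemma derivs0 s : derivs s 0 = 0.
Proof. by elim: s => //= i s ->; rewrite mderiv0. Qed.

Lemma derivsMl s f g : (forall i, g^`M(i) = 0) -> derivs s (g * f) = g * derivs s f.
Proof. by move=> g0; elim: s => //= i s ->; rewrite mderivM g0 mul0r add0r. Qed.

Lemma ord_ge_derivs x a s f : ord_ge x a f -> ord_ge x (a - size s) (derivs s f).
Proof.
move=> af; elim: s => [|i s IH] /=; first by rewrite subn0.
by rewrite subnS; apply: ord_ge_mderiv.
Qed.

Lemma mderiv_exp i f k : (f ^+ k)^`M(i) = f^`M(i) * f ^+ k.-1 *+ k.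
Proof.
elim: k => [|k IH]; first by rewrite expr0 -mpolyC1 mderivC.
rewrite exprS mderivM IH mulrnAr mulrCA; case: k {IH} => [|k] /=.
  by rewrite mulr0n addr0.
by rewrite -exprS [X in _ = X]mulrS.
Qed.

Lemma msize_mderiv i f : f^`M(i) != 0 -> (msize f^`M(i) < msize f)%N.
Proof.
move=> f0; rewrite -(mlead_deg f0); set m := mlead _.
have : f^`M(i)@_m != 0 by rewrite mleadc_eq0.
rewrite mcoeff_mderiv => nz; have : (m + U_(i))%MM \in msupp f.
  by rewrite mcoeff_msupp; apply: contraNneq nz => ->; rewrite mul0rn.
by move=> /msize_mdeg_lt; rewrite mdegD mdeg1 addn1.
Qed.

Lemma msize_exp f k : f != 0 -> msize (f ^+ k) = ((msize f).-1 * k).+1.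
Proof.
move=> f0; have f1 : (0 < msize f)%N by rewrite lt0n msize_poly_eq0.
elim: k => [|k IH]; first by rewrite expr0 msize1 muln0.
by rewrite exprS msizeM ?expf_neq0 // IH; nia.
Qed.

(** Each differentiation lowers the size, so the process stops after at most as many steps as
    degrees are lost; this count yields the gain in [msize_ge_pchar]. *)
Lemma exhaust_derivs f : f != 0 -> exists s,
  [/\ derivs s f != 0, forall i, (derivs s f)^`M(i) = 0
    & (msize (derivs s f) + size s <= msize f)%N].
Proof.
have [k] := ubnP (msize f); elim: k f => // k IH f; rewrite ltnS => fk f0.
have [no|] := pselect (forall i, f^`M(i) = 0); first by exists [::]; rewrite addn0.
move=> /existsNP[i /eqP fi0]; have fi := msize_mderiv fi0.
have [||s [s0 s1 s2]] := IH (f^`M(i)) => //; first exact: leq_trans fi fk.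
have sE : derivs (rcons s i) f = derivs s f^`M(i) by rewrite /derivs foldr_rcons.
exists (rcons s i); rewrite sE size_rcons; split=> //.
by rewrite addnS; apply: leq_ltn_trans s2 fi.
Qed.

End IteratedDerivatives.

Section PositiveCharacteristic.
Context (K : closedFieldType) (p : nat) (pK : p \in [pchar K]).

Let p_prime : prime p. Proof. exact: pcharf_prime pK. Qed.
Let p_gt0 : (0 < p)%N. Proof. exact: prime_gt0. Qed.

Lemma pchar_mpoly n : p \in [pchar {mpoly K[n]}].
Proof. by rewrite (pchar_lalg {mpoly K[n]}). Qed.

Lemma pth_root_closed (c : K) : exists d, d ^+ p = c.
Proof.
have [d dE] := solve_monicpoly (fun i => if i == 0%N then c else 0) p_gt0.
exists d; rewrite dE; case: (p) p_gt0 => // q _; rewrite big_ord_recl /= mulr1.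
by rewrite big1 ?addr0 // => i _; rewrite mul0r.
Qed.

(** Vanishing derivatives force all exponents to be multiples of [p]; the coefficients have [p]-th
    roots in [K], and Frobenius is additive. *)
Lemma mderiv0_pth_power n (f : {mpoly K[n]}) :
  (forall i, f^`M(i) = 0) -> exists g, f = g ^+ p.
Proof.
move=> f0; have pm m i : m \in msupp f -> (p %| m i)%N.
  rewrite mcoeff_msupp => fm; case: (posnP (m i)) => [->|mi]; first exact: dvdn0.
  have := congr1 (mcoeff (m - U_(i))%MM) (f0 i).
  rewrite mcoeff_mderiv mcoeff0 submK; last by rewrite lep1mP -lt0n.
  rewrite mnmBE mnm1E eqxx subn1 prednK // -mulr_natr => /eqP.
  by rewrite mulf_eq0 (negPf fm) /= (dvdn_pcharf pK).
have [e eE] := choice pth_root_closed.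
exists (\sum_(m <- msupp f) e f@_m *: 'X_[[multinom m i %/ p | i < n]]).
have frobE h : h ^+ p = pFrobenius_aut (pchar_mpoly n) h by [].
rewrite frobE rmorph_sum /= {1}(mpolyE f); apply: eq_big_seq => m mf.
rewrite -frobE exprZn eE mpolyXn; congr (_ *: 'X_[_]); apply/mnmP => i.
by rewrite mulmnE mnmE divnK // pm.
Qed.

Lemma mderiv_pth_power n (f : {mpoly K[n]}) i : (f ^+ p)^`M(i) = 0.
Proof. by rewrite mderiv_exp -mulr_natr (pcharf0 (pchar_mpoly n)) mulr0. Qed.

(* By the pigeonhole principle a monomial of degree at least [p * (t + N - 1)]
   in [N] linear forms is divisible by the [p]-th power of one of degree [t],
   and derivations are linear over [p]-th powers. *)
Lemma ord_ge_all_derivs N (x : 'I_N.+1 * ('I_N.+1 -> K)) t f s : (0 < N)%N -> (0 < t)%N ->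
  ord_ge x (p * (t + N).-1) f -> ord_ge x (t * p) (derivs s f).
Proof.
move=> N0 t0; move: f; apply: ord_ge_ind => [|f g|c m mw].
- by rewrite derivs0; apply: ord_ge0.
- by rewrite derivsD; apply: ord_geD.
pose m' := [multinom if i == x.1 then 0%N else (m i %/ p)%N | i < N.+1].
have linE : line_monomial x m = line_monomial x m' ^+ p * line_monomial x (m - m' *+ p)%MM.
  rewrite /line_monomial -prodrXl -big_split /=; apply: eq_bigr => i _.
  rewrite -exprM -exprD; congr (_ ^+ _); rewrite mnmBE mulmnE mnmE.
  by case: eqP => // _; rewrite subnKC // leq_trunc_div.
rewrite linE -mul_mpolyC mulrCA derivsMl; last by move=> i; apply: mderiv_pth_power.
apply: ord_geMr; apply: ord_ge_exp.
have wm' : (t <= wt x.1 m')%N.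
  have : (wt x.1 m <= \sum_(i | i != x.1) (m' i * p + p.-1))%N.
    apply: leq_sum => i ix; rewrite mnmE (negPf ix) {1}(divn_eq (m i) p) leq_add2l.
    by rewrite -ltnS prednK // ltn_pmod.
  rewrite big_split /= -big_distrl /= sum_nat_const.
  have -> : #|[pred i | i != x.1]| = N by rewrite cardC1 card_ord.
  rewrite -/(wt x.1 m') => /(leq_trans mw) le; rewrite leqNgt; apply/negP => Wt.
  (* A weight of [m'] below [t] would bound the weight of [m] by [p (t - 1) + N (p - 1)], less than
     [p (t + N - 1)]. *)
  have : ((wt x.1 m' + 1) * p <= t * p)%N by rewrite leq_mul2r addn1 Wt orbT.
  case: (p) p_gt0 le => // q _; nia.
apply: ord_ge_leq wm' _; rewrite /line_monomial /wt big_mkcond.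
elim/big_ind2: _ => // [a g b h|i _]; first exact: ord_geM.
case: (eqVneq i x.1) => //= ix.
have := @ord_ge_exp _ _ x 1 (m' i) (line_coord x i); rewrite mul1n; apply.
exact: ord_ge1_line_coord.
Qed.

(* Differentiate [f] as long as possible, down to some [h ^+ p]. All derivatives
   of [f] vanish to order [t * p], so [h] vanishes to order [t] and has degree
   at least [a]. If [deg f < p * (a + 1)] there were fewer than [p]
   differentiations, so that [deg h = a] and [h] vanishes to order [t + N - 1]:
   a nonzero first derivative of [h] contradicts the minimality of [a]. *)
Lemma msize_ge_pchar N (X : 'I_N.+1 * ('I_N.+1 -> K) -> Prop) t a f :
  (0 < N)%N -> (0 < t)%N -> (0 < a < p)%N ->
  (forall g, g != 0 -> (forall x, X x -> ord_ge x t g) -> (a < msize g)%N) ->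
  f != 0 -> (forall x, X x -> ord_ge x (p * (t + N).-1) f) ->
  (p * (a + (1 < N)%N) < msize f)%N.
Proof.
move=> N0 t0 /andP[a0 ap] minX f0 fX.
have [s [e0 e' es]] := exhaust_derivs f0; have [h eE] := mderiv0_pth_power e'.
have h0 : h != 0 by apply: contraNneq e0 => h0; rewrite eE h0 expr0n (gtn_eqF p_gt0).
have ha : (a < msize h)%N.
  apply: minX => // x Xx; rewrite -(prednK t0); apply: (ord_ge_expK p_gt0).
  rewrite -eE; apply: ord_ge_leq (ord_ge_all_derivs s N0 t0 (fX x Xx)).
  by have := p_gt0; rewrite -{2}(prednK t0) mulSn; lia.
have eh : msize (derivs s f) = ((msize h).-1 * p).+1 by rewrite eE msize_exp.
have {}es : ((msize h).-1 * p + size s < msize f)%N.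
  by apply: leq_trans es; rewrite eh addSn.
have ahp : (a * p <= (msize h).-1 * p)%N by apply: leq_mul => //; lia.
case: (ltnP 1 N) => N1; last by rewrite addn0 mulnC; lia.
rewrite addn1 ltnNge; apply/negP => fp.
have hsz : msize h = a.+1.
  apply/eqP; rewrite eqn_leq ha andbT leqNgt; apply/negP => ah.
  have : (a.+1 * p <= (msize h).-1 * p)%N by apply: leq_mul => //; lia.
  by rewrite (mulnC a.+1); lia.
have sp : (size s < p)%N by move: fp; rewrite mulnS mulnC; lia.
(* Fewer than [p] differentiations leave [h ^+ p] an order above [p (t + N - 2)]. *)
have hX x : X x -> ord_ge x (t + N).-1 h.
  move=> Xx; have -> : ((t + N).-1 = (t + N).-2.+1)%N by lia.
  apply: (ord_ge_expK p_gt0); rewrite -eE.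
  apply: ord_ge_leq (@ord_ge_derivs _ _ _ _ s _ (fX x Xx)).
  by have -> : ((t + N).-1 = (t + N).-2.+1)%N by [lia]; rewrite mulnS /= mulnC; lia.
(* If [h] were itself a [p]-th power, its degree [a] would be a multiple of [p], but [0 < a < p]. *)
have [h'|] := pselect (forall i, h^`M(i) = 0).
  have [g hE] := mderiv0_pth_power h'.
  have g0 : g != 0 by apply: contraNneq h0 => g0; rewrite hE g0 expr0n (gtn_eqF p_gt0).
  by move: hsz; rewrite hE msize_exp // => -[ga]; nia.
move=> /existsNP[i /eqP hi0]; have := msize_mderiv hi0.
rewrite hsz ltnS leqNgt => /negP[]; apply: minX => // x Xx.
by apply: ord_ge_leq (@ord_ge_mderiv _ _ _ _ _ i (hX x Xx)); lia.
Qed.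

End PositiveCharacteristic.

(** * Specialization to positive characteristic *)

Section Specialization.
Context (C : fieldType) (C0 : [pchar C] =i pred0).

(** A form of the Nullstellensatz over the integers for the image of [iota]: its nonzero elements
    survive in positive characteristic. Maps on [A] that kill the kernel of [iota] stand for maps on
    this image. *)
Definition specializable (A : comNzRingType) (iota : {rmorphism A -> C}) :=
  forall g, iota g != 0 ->
  exists (p : nat) (K : closedFieldType) (phi : {rmorphism A -> K}),
    [/\ p \in [pchar K], forall a, iota a = 0 -> phi a = 0 & phi g != 0].

Lemma natr_neq0 k : (0 < k)%N -> k%:R != 0 :> C.
Proof. by move=> k0; rewrite (pcharf0P C).1 // -lt0n. Qed.

Lemma intr_eq0_pchar (R : nzRingType) (z : int) : (z%:~R == 0 :> R) = (`|z|%N%:R == 0 :> R).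
Proof.
by case: z => k; rewrite ?NegzE ?abszN //= mulrNz oppr_eq0.
Qed.

Lemma specializable_int : specializable (intmul 1 : {rmorphism int -> C}).
Proof.
move=> g; rewrite intr_eq0_pchar => g0.
have [p gp pp] := prime_above `|g|%N.
have [K [phi _]] := countable_algebraic_closure 'F_p.
exists p, K, (intmul 1 : {rmorphism int -> K}); split.
- by rewrite (fmorph_pchar phi) pchar_Fp.
- move=> a /eqP; rewrite intr_eq0_pchar => a0; apply/eqP; rewrite intr_eq0_pchar.
  by have [-> //|/natr_neq0] := posnP `|a|; rewrite a0.
- rewrite intr_eq0_pchar -(dvdn_pcharf (p := p)); last by rewrite (fmorph_pchar phi) pchar_Fp.
  apply/negP => pg; have g1 : (0 < `|g|)%N.
    by rewrite lt0n; apply: contraNneq g0 => ->.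
  by have := dvdn_leq g1 pg; rewrite leqNgt gp.
Qed.

Lemma map_take_poly (R S : nzRingType) (f : {rmorphism R -> S}) (p : {poly R}) :
  map_poly f (take_poly (size (map_poly f p)) p) = map_poly f p.
Proof.
apply/polyP => i; rewrite !coef_map coef_take_poly; case: ltnP => // pi.
by rewrite raddf0 -coef_map nth_default.
Qed.

Lemma map_poly_ker (A K : nzRingType) (iota : {rmorphism A -> C}) (phi : {rmorphism A -> K})
    (f : {poly A}) :
  (forall a, iota a = 0 -> phi a = 0) -> map_poly iota f = 0 -> map_poly phi f = 0.
Proof.
move=> ker f0; apply/polyP => i; rewrite coef_map coef0; apply: ker.
by rewrite -coef_map f0 coef0.
Qed.

(** * Adjoining one element to the base ring *)

Section Adjunction.
Context (A : comNzRingType) (iota : {rmorphism A -> C}) (c : C).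
Hypothesis iotaS : specializable iota.

Let iotap : {poly A} -> {poly C} := map_poly iota.
Let ev : {rmorphism {poly A} -> C} := horner_eval c \o map_poly iota.

Lemma ev_horner f : ev f = (iotap f).[c]. Proof. by []. Qed.
Lemma evC a : ev a%:P = iota a. Proof. by rewrite ev_horner /iotap map_polyC hornerC. Qed.
Lemma evD f g : ev (f + g) = ev f + ev g. Proof. exact: rmorphD. Qed.
Lemma evM f g : ev (f * g) = ev f * ev g. Proof. exact: rmorphM. Qed.
Lemma evN f : ev (- f) = - ev f. Proof. exact: rmorphN. Qed.
Lemma evZ a f : ev (a *: f) = iota a * ev f.
Proof. by rewrite -mul_polyC rmorphM evC. Qed.

(** The map [iota] may kill the leading coefficient of [f]; dropping the top terms it kills allows
    division by [f']. *)
Lemma truncate f : iotap f != 0 -> exists f',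
  [/\ iotap f' = iotap f, size f' = size (iotap f) & iota (lead_coef f') != 0].
Proof.
move=> f0; exists (take_poly (size (iotap f)) f).
have fE : iotap (take_poly (size (iotap f)) f) = iotap f by apply: map_take_poly.
have sz : size (take_poly (size (iotap f)) f) = size (iotap f).
  apply/eqP; rewrite eqn_leq size_take_poly /= -{1}fE; exact: size_poly.
by split=> //; rewrite lead_coefE sz -coef_map [map_poly _ _]fE -lead_coefE lead_coef_eq0.
Qed.

Lemma pseudo_division d f : iota (lead_coef d) != 0 -> exists k q r,
  lead_coef d ^+ k *: f = q * d + r /\ (size r < size d)%N.
Proof.
move=> d0; case: (Pdiv.ComRing.redivpP f d) => k q r fE rd; exists k, q, r; split=> //.
by apply: rd; apply: contraNneq d0 => ->; rewrite lead_coef0 rmorph0.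
Qed.

Lemma minimal_size (P : {poly A} -> Prop) f : P f ->
  exists2 h, P h & forall h', P h' -> (size (iotap h) <= size (iotap h'))%N.
Proof.
have [k] := ubnP (size (iotap f)); elim: k f => // k IH f; rewrite ltnS => fk Pf.
have [|/existsNP[h /not_implyP[Ph /negP]]] :=
  pselect (forall h, P h -> (size (iotap f) <= size (iotap h))%N); first by exists f.
by rewrite -ltnNge => hf; apply: IH Ph; apply: leq_trans hf fk.
Qed.

Lemma size_iotap f : (size (iotap f) <= size f)%N.
Proof. exact: size_poly. Qed.

(** When [c] is transcendental, [phi] need only keep one coefficient of [g]: the image of [g] is
    then a nonzero polynomial, and any non-root of it can be the image of [c]. *)
Lemma specializable_transcendental : (forall f, ev f = 0 -> iotap f = 0) -> specializable ev.
Proof.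
move=> tr g evg; have : iotap g != 0.
  by apply: contraNneq evg; rewrite ev_horner => ->; rewrite horner0.
rewrite -lead_coef_eq0 lead_coefE coef_map => /iotaS[p [K [phi [pK ker nz]]]].
have : map_poly phi g != 0.
  by apply: contraNneq nz => g0; rewrite -coef_map g0 coef0.
move=> /closed_nonrootP[b nb]; exists p, K, (horner_eval b \o map_poly phi).
split=> // f /tr f0 /=; rewrite /horner_eval.
by rewrite (map_poly_ker ker f0) horner0.
Qed.

(* [h] is a polynomial of least degree vanishing at [c]; a root of its image
   under [phi] extends [phi] as soon as [phi] does not kill its leading
   coefficient. *)
Lemma specializable_algebraic f0 : ev f0 = 0 -> iotap f0 != 0 -> specializable ev.
Proof.
move=> evf0 nzf0 g evg.
have [h [evh nzh] hmin] := @minimal_size (fun f => ev f = 0 /\ iotap f != 0) f0 (conj evf0 nzf0).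
have [h1 [h1E h1sz h1l]] := truncate nzh.
have {h evh nzh h1E h1sz hmin} [h [evh hl hmin]] : exists h, [/\ ev h = 0,
    iota (lead_coef h) != 0 & forall f, ev f = 0 -> (size (iotap f) < size h)%N -> iotap f = 0].
  exists h1; split=> // [|f evf]; first by rewrite ev_horner h1E.
  by rewrite h1sz ltnNge => fh; apply/eqP/negPn/negP => nzf; move/negP: fh; apply; apply: hmin.
have rem0 f : ev f = 0 -> (size f < size h)%N -> iotap f = 0.
  by move=> evf fh; apply: hmin => //; apply: leq_ltn_trans (size_iotap f) fh.
have nzh : iotap h != 0.
  by apply: contraNneq hl => h0; rewrite lead_coefE -coef_map [map_poly _ _]h0 coef0.
(* Some multiple of the value of [g] is the nonzero value of a constant. Indeed, a multiple of least
   size is constant: otherwise dividing [h] by it leaves no remainder, and the cofactor [q']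
   vanishes at [c], against the minimality of [h]. *)
have [a [w [aw nza]]] : exists a w, ev (w * g) = iota a /\ iota a != 0.
  pose P f := ev f != 0 /\ exists w, ev f = ev (w * g).
  have Pg : P g by split=> //; exists 1; rewrite mul1r.
  have [f [evf [w fw]] fmin] := minimal_size Pg.
  have nzf : iotap f != 0 by apply: contraNneq evf; rewrite ev_horner => ->; rewrite horner0.
  have [f1 [f1E f1sz f1l]] := truncate nzf.
  have f1w : ev f1 = ev (w * g) by rewrite ev_horner f1E -ev_horner.
  have evf1 : ev f1 != 0 by rewrite f1w -fw.
  have {}fmin r : ev r != 0 -> (exists w', ev r = ev (w' * g)) -> (size f1 <= size r)%N.
    by move=> ??; rewrite f1sz; apply: leq_trans (fmin r _) (size_iotap r).
  have [f1s|f1s] := leqP (size f1) 1.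
    by exists f1`_0, w; rewrite -f1w -evC -size1_polyC.
  have [k [q [r [rE rsz]]]] := pseudo_division f1 hl.
  have evr : ev r = iota (lead_coef h ^+ k) * ev f1.
    by rewrite -evZ rE evD evM evh mulr0 add0r.
  have f1h : (size f1 < size h)%N.
    apply: leq_ltn_trans rsz; apply: fmin.
      by rewrite evr mulf_neq0 // rmorphXn expf_neq0.
    by exists (lead_coef h ^+ k *: w); rewrite evr f1w -evZ scalerAl.
  have [k' [q' [r' [r'E r'sz]]]] := pseudo_division h f1l.
  have evr' : ev r' = ev (- q' * f1).
    by apply/eqP; rewrite mulNr evN -addr_eq0 addrC -evD -r'E evZ evh mulr0.
  have evr'0 : ev r' = 0.
    apply/eqP/negPn/negP => nz; have := fmin r' nz; rewrite leqNgt r'sz => /(_ _)/negP; apply=> //.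
    by exists (- q' * w); rewrite evr' -mulrA !(evM (- q')) f1w.
  have iotar' : iotap r' = 0 by apply: rem0 evr'0 (ltn_trans r'sz f1h).
  have evq' : iotap q' = 0.
    have prodE : iota (lead_coef f1 ^+ k') *: iotap h = iotap q' * iotap f1.
      by rewrite -[LHS]map_polyZ r'E rmorphD /= rmorphM /= [X in _ + X]iotar' addr0.
    have [//|q'0] := eqVneq (iotap q') 0.
    have f1n : iotap f1 != 0 by rewrite f1E.
    apply: hmin.
      apply/eqP; move: evr'0; rewrite evr' evM evN => /eqP.
      by rewrite mulf_eq0 oppr_eq0 (negPf evf1) orbF.
    have sz : size (iotap h) = (size (iotap q') + size f1).-1.
      rewrite f1sz -f1E -size_mul // -prodE size_scale //.
      by rewrite rmorphXn expf_neq0.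
    apply: leq_trans (size_iotap h); rewrite sz.
    by case: (size f1) f1s => [|[|s]] // _; rewrite !addnS /= ltnS leq_addr.
  exfalso; move/eqP: nzh; apply; apply/eqP.
  have : iota (lead_coef f1 ^+ k') *: iotap h = 0.
    rewrite -[LHS]map_polyZ r'E rmorphD /= rmorphM /= [X in _ + X]iotar' addr0.
    by rewrite [X in X * _]evq' mul0r.
  by move/eqP; rewrite scaler_eq0 rmorphXn expf_eq0 (negPf f1l) andbF.
(* Keeping [lead_coef h] preserves the degree of [h], so that its image has a root; keeping [a] will
   keep [g]. *)
have [|p [K [phi [pK ker]]]] := iotaS (g := lead_coef h * a); first by rewrite rmorphM mulf_neq0.
rewrite rmorphM mulf_eq0 negb_or => /andP[phil phia].
have hsz : size (map_poly phi h) = size h.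
  apply/eqP; rewrite eqn_leq size_poly /= leqNgt; apply/negP => lt.
  move/eqP: phil; apply; rewrite lead_coefE -coef_map nth_default //.
  by rewrite -ltnS prednK // (leq_trans _ lt).
have /closed_rootP[b rb] : size (map_poly phi h) != 1.
  rewrite hsz; apply: contraNneq hl => hs1; have /size1_polyC hE : (size h <= 1)%N by rewrite hs1.
  by rewrite hE lead_coefC -evC -hE evh.
have kerp f : iotap f = 0 -> map_poly phi f = 0.
  exact: map_poly_ker.
pose ev' : {rmorphism {poly A} -> K} := horner_eval b \o map_poly phi.
have ev'Z d f : ev' (d *: f) = phi d * ev' f.
  by rewrite -mul_polyC rmorphM /= /horner_eval map_polyC hornerC.
(* Up to a power of the leading coefficient of [h], which [phi] keeps, [f] is a multiple of [h] plus
   a remainder too small to vanish at [c] without being killed. *)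
have ker' f : ev f = 0 -> ev' f = 0.
  move=> evf; have [k [q [r [rE rsz]]]] := pseudo_division f hl.
  have evr : ev r = 0.
    have := congr1 ev rE; rewrite evZ evf mulr0 evD evM.
    by rewrite evh mulr0 add0r => <-.
  have ev'r : ev' r = 0 by rewrite /= /horner_eval kerp ?horner0 //; apply: rem0.
  have := congr1 ev' rE; rewrite ev'Z rmorphD rmorphM [X in _ + X]ev'r.
  rewrite [X in _ * X + _](_ : _ = 0) ?mulr0 ?addr0; last exact/eqP.
  by move/eqP; rewrite mulf_eq0 rmorphXn expf_eq0 (negPf phil) andbF /= => /eqP.
exists p, K, ev'; split=> //.
have /ker' : ev (w * g - a%:P) = 0 by rewrite evD evN evC aw subrr.
rewrite rmorphB rmorphM => /eqP; rewrite subr_eq0 => /eqP wg.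
apply: contraNneq phia => g0; move: wg; rewrite g0 mulr0 /= /horner_eval map_polyC hornerC.
by move=> <-.
Qed.

Lemma specializable_poly : specializable ev.
Proof.
have [|] := pselect (forall f, ev f = 0 -> iotap f = 0).
  exact: specializable_transcendental.
by move=> /existsNP[f /not_implyP[evf /eqP nzf]]; apply: specializable_algebraic evf nzf.
Qed.

End Adjunction.

(* [iota] need not be injective: this spares us forming subrings of [C]. *)
Lemma specializable_lift (l : seq C) :
  exists (A : comNzRingType) (iota : {rmorphism A -> C}),
    specializable iota /\ forall c, c \in l -> exists a, iota a = c.
Proof.
elim: l => [|c l [A [iota [iotaS lA]]]].
  by exists int, (intmul 1 : {rmorphism int -> C}); split=> //; apply: specializable_int.
exists {poly A}, (horner_eval c \o map_poly iota); split; first exact: specializable_poly.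
move=> d; rewrite inE => /predU1P[->|/lA[a <-]].
  by exists 'X; rewrite /= /horner_eval map_polyX hornerX.
by exists a%:P; rewrite /= /horner_eval map_polyC hornerC.
Qed.

(** A characteristic at most [B] would kill [B!], which is nonzero in [C]. *)
Lemma specialization (l : seq C) (B : nat) :
  exists (A : comNzRingType) (iota : {rmorphism A -> C}) (lift : C -> A)
         (p : nat) (K : closedFieldType) (phi : {rmorphism A -> K}),
    [/\ {in l, forall c, iota (lift c) = c}, p \in [pchar K], (B < p)%N
      & forall a, iota a = 0 -> phi a = 0].
Proof.
have [A [iota [iotaS lA]]] := specializable_lift l.
have /choice[lift liftE] c : exists a, c \in l -> iota a = c.
  by have [/lA[a ac]|_] := boolP (c \in l); [exists a | exists 0].
have [|p [K [phi [pK ker nz]]]] := iotaS B`!%:R.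
  by rewrite rmorph_nat natr_neq0 // fact_gt0.
exists A, iota, lift, p, K, phi; split=> //; rewrite ltnNge; apply/negP => pB.
move: nz; rewrite rmorph_nat -(dvdn_pcharf pK) dvdn_fact //.
by rewrite pB prime_gt0 // (pcharf_prime pK).
Qed.

End Specialization.

(** * The degree bound in characteristic zero *)

Section Transfer.
Context (A B : comNzRingType) (phi : {rmorphism A -> B}) (n : nat).

Definition map_coords (x : 'I_n * ('I_n -> A)) : 'I_n * ('I_n -> B) := (x.1, phi \o x.2).

Lemma map_dilation_gen x i :
  map_poly (map_mpoly phi) (dilation_gen x i) = dilation_gen (map_coords x) i.
Proof.
rewrite /dilation_gen /=; case: eqP => _; first by rewrite map_polyC /= map_mpolyX.
by rewrite rmorphD rmorphM /= !map_polyC map_polyX /= map_mpolyZ !map_mpolyX.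
Qed.

Lemma map_dilation x f :
  map_poly (map_mpoly phi) (dilation x f) = dilation (map_coords x) (map_mpoly phi f).
Proof.
rewrite [in LHS](mpolyE f) [in RHS](mpolyE f).
rewrite (raddf_sum (dilation x)) (raddf_sum (map_mpoly phi)) (raddf_sum (dilation (map_coords x))).
rewrite (raddf_sum (map_poly _)) /=; apply: eq_bigr => m _.
rewrite map_mpolyZ map_mpolyX !dilationZ rmorphM /= map_polyC /= map_mpolyC.
congr (_ * _); rewrite !dilationX rmorph_prod /=; apply: eq_bigr => i _.
by rewrite rmorphXn /= map_dilation_gen.
Qed.

Lemma map_coef_dilation x f j m :
  phi (dilation x f)`_j@_m = (dilation (map_coords x) (map_mpoly phi f))`_j@_m.
Proof. by rewrite -map_dilation coef_map /= mcoeff_map_mpoly. Qed.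

End Transfer.

(** The coefficients that have to vanish are images of elements of [A]: those killed by [iota] are
    killed by [phi]. *)
Lemma ord_ge_ker (A B C : comNzRingType) (iota : {rmorphism A -> C}) (phi : {rmorphism A -> B})
    n (x : 'I_n * ('I_n -> A)) s f :
  (forall a, iota a = 0 -> phi a = 0) ->
  ord_ge (map_coords iota x) s (map_mpoly iota f) -> ord_ge (map_coords phi x) s (map_mpoly phi f).
Proof.
move=> ker sf j js; apply/mpolyP => m; rewrite mcoeff0 -map_coef_dilation; apply: ker.
by rewrite map_coef_dilation sf ?mcoeff0.
Qed.

Lemma msize_leq (A B : nzRingType) n (f : {mpoly A[n]}) (g : {mpoly B[n]}) :
  (forall m, f@_m = 0 -> g@_m = 0) -> (msize g <= msize f)%N.
Proof.
move=> fg; rewrite msizeE; apply/bigmax_leqP_seq => m mg _.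
apply: msize_mdeg_lt; move: mg; rewrite !mcoeff_msupp; apply: contraNneq.
by move=> /fg ->.
Qed.

(* [order_mx] is the matrix of the linear system expressing that a polynomial
   of degree less than [a] vanishes to order [t] at the points [X i]. That the
   system has only the zero solution is witnessed by a one-sided inverse, a
   condition which survives specialization. *)
Section OrderMatrix.
Context (A : comNzRingType) (n k a t : nat) (X : 'I_k -> 'I_n * ('I_n -> A)).

Local Notation cond := ('I_k * 'I_t * 'X_{1..n < a})%type.

Definition order_mx : 'M[A]_(#|{: 'X_{1..n < a}}|, #|{: cond}|) :=
  \matrix_(i < #|{: 'X_{1..n < a}}|, c < #|{: cond}|)
    (dilation (X (enum_val c).1.1) 'X_[enum_val i])`_(enum_val c).1.2@_(enum_val c).2.

Definition mpoly_of_row (u : 'rV[A]_#|{: 'X_{1..n < a}}|) : {mpoly A[n]} :=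
  \sum_(m : 'X_{1..n < a}) u 0 (enum_rank m) *: 'X_[m].

Definition row_of_mpoly (f : {mpoly A[n]}) : 'rV[A]_#|{: 'X_{1..n < a}}| :=
  \row_(i < #|{: 'X_{1..n < a}}|) f@_(enum_val i).

Lemma mpoly_of_rowE (u : 'rV_#|{: 'X_{1..n < a}}|) (i : 'I_#|{: 'X_{1..n < a}}|) :
  (mpoly_of_row u)@_(enum_val i) = u 0 i.
Proof.
rewrite raddf_sum /= (bigD1 (enum_val i)) //= mcoeffZ mcoeffX eqxx mulr1 enum_valK.
rewrite big1 ?addr0 // => m mi; rewrite mcoeffZ mcoeffX.
by rewrite -bmeqP (negPf mi) mulr0.
Qed.

Lemma row_of_mpolyK f : (msize f <= a)%N -> mpoly_of_row (row_of_mpoly f) = f.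
Proof.
move=> fa; rewrite [RHS](mpolywE fa); apply: eq_bigr => m _.
by rewrite mxE enum_rankK.
Qed.

Lemma msize_mpoly_of_row u : (msize (mpoly_of_row u) <= a)%N.
Proof.
apply: leq_trans (msize_sum _ _ _) _; apply/bigmax_leqP => m _.
by apply: leq_trans (msizeZ_le _ _) _; rewrite msizeX; apply: bmdeg.
Qed.

Lemma order_mxE (u : 'rV_#|{: 'X_{1..n < a}}|) (c : 'I_#|{: cond}|) : (u *m order_mx) 0 c =
  (dilation (X (enum_val c).1.1) (mpoly_of_row u))`_(enum_val c).1.2@_(enum_val c).2.
Proof.
rewrite !mxE raddf_sum /= coef_sum raddf_sum /= (reindex enum_rank) /=; last first.
  by exists enum_val => m _; rewrite ?enum_rankK ?enum_valK.
apply: eq_bigr => m _; rewrite mxE enum_rankK dilationZ coefCM mul_mpolyC mcoeffZ.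
by [].
Qed.

Lemma mul_order_mx0 (u : 'rV_#|{: 'X_{1..n < a}}|) : u *m order_mx = 0 <->
  forall i, ord_ge (X i) t (mpoly_of_row u).
Proof.
split=> [u0 i j jt|uX]; last first.
  by apply/matrixP => i0 c; rewrite ord1 order_mxE mxE uX ?mcoeff0.
apply/mpolyP => m; rewrite mcoeff0; have [ma|am] := ltnP (mdeg m) a.
  have := order_mxE u (enum_rank ((i, Ordinal jt, BMultinom ma) : cond)).
  by rewrite enum_rankK u0 mxE.
(* The matrix only tests monomials of degree less than [a]; no others occur, since the dilation
   preserves degree. *)
apply/eqP/negPn/negP => /coef_dilation_neq0[m' /msize_mdeg_lt m'u [_ mm']].
by move: m'u; rewrite ltnNge -mm' => /negP[]; apply: leq_trans (msize_mpoly_of_row u) am.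
Qed.

End OrderMatrix.

Lemma map_order_mx (A B : comNzRingType) (phi : {rmorphism A -> B}) n k a t
    (X : 'I_k -> 'I_n * ('I_n -> A)) :
  map_mx phi (order_mx a t X) = order_mx a t (fun i => map_coords phi (X i)).
Proof. by apply/matrixP => i c; rewrite !mxE map_coef_dilation map_mpolyX. Qed.

Lemma order_mx_left_inverse (C : fieldType) n k a t (X : 'I_k -> 'I_n * ('I_n -> C)) :
  (forall g, g != 0 -> (forall i, ord_ge (X i) t g) -> (a < msize g)%N) ->
  exists L, order_mx a t X *m L = 1%:M.
Proof.
move=> minX; apply/row_freeP; rewrite -kermx_eq0; apply/rowV0P => u /sub_kermxP u0.
have [f0|/minX] := eqVneq (mpoly_of_row u) 0.
  by apply/rowP => i; rewrite -mpoly_of_rowE f0 mcoeff0 mxE.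
by move=> /(_ ((mul_order_mx0 t X u).1 u0)); rewrite ltnNge msize_mpoly_of_row.
Qed.

Lemma msize_gt_of_left_inverse (K : comNzRingType) n k a t (X : 'I_k -> 'I_n * ('I_n -> K)) L :
  order_mx a t X *m L = 1%:M ->
  forall g, g != 0 -> (forall i, ord_ge (X i) t g) -> (a < msize g)%N.
Proof.
move=> ML g g0 gX; rewrite ltnNge; apply/negP => ga; move/negP: g0; apply; apply/eqP.
have /(congr1 (mulmxr L)) /= : row_of_mpoly a g *m order_mx a t X = 0.
  by apply/mul_order_mx0 => i; rewrite row_of_mpolyK.
rewrite -mulmxA ML mulmx1 mul0mx => g0; rewrite -(row_of_mpolyK ga) g0.
by apply: big1 => m _; rewrite mxE scale0r.
Qed.

Section LowerBound.
Context (C : fieldType) (C0 : [pchar C] =i pred0) (N k : nat).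
Context (X : 'I_k -> 'I_N.+1 * ('I_N.+1 -> C)).

(** Were the inequality false, its sides would differ by at least one. Multiplied by [p], this gap
    exceeds the error [d * s] made by rounding the exponent [r]. *)
Theorem degree_lower_bound t a s f : (0 < N)%N -> (0 < t)%N -> (0 < a)%N -> (0 < s)%N ->
  (forall g, g != 0 -> (forall i, ord_ge (X i) t g) -> (a < msize g)%N) ->
  f != 0 -> (forall i, ord_ge (X i) s f) ->
  ((a + (1 < N)%N) * s <= (msize f).-1 * (t + N).-1)%N.
Proof.
move=> N0 t0 a0 s0 minX f0 fX; rewrite leqNgt; apply/negP => lt.
have [L ML] := order_mx_left_inverse minX.
set d := (msize f).-1 in lt.
have [m0 m0f] : exists m0, f@_m0 != 0.
  by exists (mlead f); rewrite mleadc_eq0.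
(* The inverse of one coefficient is included so that [f] does not specialize to zero; the entries
   of [L] carry the minimality of [a] over. *)
pose l := (f@_m0)^-1 :: [seq f@_m | m <- msupp f] ++
  [seq L i j | i <- enum 'I__, j <- enum 'I__] ++
  [seq (X i).2 j | i <- enum 'I_k, j <- enum 'I_N.+1].
(* The bound [a < p] is required by [msize_ge_pchar], and [d * s < p] by the final comparison. *)
have [A [iota [lift [p [K [phi [liftK pK Bp ker]]]]]]] := specialization C0 l (d * s + a).
have liftL i j : iota (lift (L i j)) = L i j.
  apply: liftK; rewrite inE !mem_cat; apply/or4P; apply: Or43.
  by apply/allpairsP; exists (i, j); rewrite !mem_enum.
have liftX i j : iota (lift ((X i).2 j)) = (X i).2 j.
  apply: liftK; rewrite inE !mem_cat; apply/or4P; apply: Or44.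
  by apply/allpairsP; exists (i, j); rewrite !mem_enum.
have liftf m : m \in msupp f -> iota (lift f@_m) = f@_m.
  move=> mf; apply: liftK; rewrite inE !mem_cat; apply/or4P; apply: Or42.
  exact: map_f.
have liftV : iota (lift (f@_m0)^-1) = (f@_m0)^-1 by apply: liftK; rewrite inE eqxx.
pose X' i := ((X i).1, lift \o (X i).2).
have X'E i : map_coords iota (X' i) = X i.
  rewrite /map_coords /X' /= [RHS]surjective_pairing; congr (_, _).
  by apply/funext => j /=.
pose f' : {mpoly A[N.+1]} := \sum_(m <- msupp f) lift f@_m *: 'X_[m].
have f'E : map_mpoly iota f' = f.
  rewrite raddf_sum /= [RHS]mpolyE; apply: eq_big_seq => m mf.
  by rewrite map_mpolyZ map_mpolyX liftf.
pose F := map_mpoly phi f'.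
have F0 : F != 0.
  apply/eqP => F0; have := congr1 (mcoeff m0) F0; rewrite mcoeff_map_mpoly mcoeff0 => e.
  have : phi (f'@_m0 * lift (f@_m0)^-1 - 1) = 0.
    by apply: ker; rewrite rmorphB rmorphM -mcoeff_map_mpoly f'E liftV rmorph1 divff ?subrr.
  by rewrite rmorphB rmorphM e mul0r rmorph1 sub0r => /eqP; rewrite oppr_eq0 oner_eq0.
have Fd : ((msize F).-1 <= d)%N.
  rewrite /d -!subn1 leq_sub2r // msize_leq // => m; rewrite -{1}f'E !mcoeff_map_mpoly.
  exact: ker.
have FX i : ord_ge (map_coords phi (X' i)) s F.
  by apply: (ord_ge_ker ker); rewrite f'E X'E.
have minF : forall g, g != 0 -> (forall i, ord_ge (map_coords phi (X' i)) t g) -> (a < msize g)%N.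
  apply: (@msize_gt_of_left_inverse _ _ _ _ _ _ (map_mx phi (map_mx lift L))).
  rewrite -map_order_mx -map_mxM; apply/matrixP => i j; rewrite !mxE.
  apply/eqP; rewrite -subr_eq0 -(rmorph_nat phi) -rmorphB; apply/eqP/ker.
  have := congr1 (fun M : 'M_ _ => M i j) ML; rewrite mxE [RHS]mxE => MLij.
  rewrite rmorphB rmorph_nat -MLij rmorph_sum; apply/eqP; rewrite subr_eq0; apply/eqP.
  apply: eq_bigr => c _; rewrite rmorphM [X in _ * iota X]mxE liftL; congr (_ * _).
  have := congr1 (fun M : 'M_(_, _) => M i c) (map_order_mx iota a t X').
  by rewrite mxE (funext X'E).
(* chosen so that [F ^+ r] vanishes to order at least [p * (t + N - 1)] *)
pose r := ((p * (t + N).-1) %/ s).+1.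
pose Y x := exists i, x = map_coords phi (X' i).
have := @msize_ge_pchar K p pK N Y t a (F ^+ r) N0 t0.
have ap : (0 < a < p)%N by rewrite a0 /=; apply: leq_ltn_trans Bp; rewrite leq_addl.
have Y_min g : g != 0 -> (forall x, Y x -> ord_ge x t g) -> (a < msize g)%N.
  by move=> g0 gY; apply: minF => // i; apply: gY; exists i.
have rs : (p * (t + N).-1 <= s * r)%N by rewrite (mulnC s) ltnW // ltn_ceil.
have rs' : (s * r <= p * (t + N).-1 + s)%N.
  by rewrite /r mulnS addnC leq_add2r (mulnC s) leq_trunc_div.
have Y_ord x : Y x -> ord_ge x (p * (t + N).-1) (F ^+ r).
  by move=> [i ->]; apply: (ord_ge_leq rs); apply: ord_ge_exp.
move=> /(_ ap Y_min (expf_neq0 _ F0) Y_ord); rewrite msize_exp // ltnS => pa.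
have {}pa : (p * ((a + (1 < N)%N) * s) <= d * (s * r))%N.
  by rewrite mulnA (mulnC s) mulnA leq_mul // (leq_trans pa) // leq_mul.
have : (d * (s * r) <= p * (d * (t + N).-1) + d * s)%N.
  by apply: leq_trans (leq_mul (leqnn d) rs') _; rewrite mulnDr mulnCA.
have : (p * (d * (t + N).-1).+1 <= p * ((a + (1 < N)%N) * s))%N by rewrite leq_mul2l lt orbT.
by rewrite mulnS; lia.
Qed.

End LowerBound.

(** * Symbolic powers of the ideal of a finite set of points *)

Section Ideals.
Context (A : comNzRingType).
Implicit Types (S J : set A) (f g : A).

Lemma mem_ideal_gen S f : S f -> ideal_gen S f.
Proof.
move=> Sf; exists 1%N, (fun=> 1), (fun=> f); split=> //.
by rewrite big_ord1 mul1r.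
Qed.

Lemma ideal_gen0 S : ideal_gen S 0.
Proof.
by exists 0%N, (fun=> 0), (fun=> 0); split; [case | rewrite big_ord0].
Qed.

Lemma ideal_genMl S f g : ideal_gen S f -> ideal_gen S (g * f).
Proof.
move=> [k [c [a [Sa ->]]]]; exists k, (fun i => g * c i), a; split=> //.
by rewrite mulr_sumr; apply: eq_bigr => i _; rewrite mulrA.
Qed.

Lemma ideal_genD S f g : ideal_gen S f -> ideal_gen S g -> ideal_gen S (f + g).
Proof.
move=> [k [c [a [Sa ->]]]] [k' [c' [a' [Sa' ->]]]].
pose glue (u : 'I_k -> A) (u' : 'I_k' -> A) i :=
  match split i with inl j => u j | inr j => u' j end.
exists (k + k')%N, (glue c c'), (glue a a'); split.
  by move=> i; rewrite /glue; case: split.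
rewrite big_split_ord; congr (_ + _); apply: eq_bigr => i _; rewrite /glue.
  by case: splitP => j /= ij; [rewrite (val_inj ij) | case: i ij => i /=; lia].
case: splitP => j /= ij; first by case: j ij => j /=; lia.
by rewrite (_ : i = j) //; apply: val_inj => /=; lia.
Qed.

Lemma ideal_gen_sum S (I : Type) (r : seq I) (P : pred I) (F : I -> A) :
  (forall i, P i -> ideal_gen S (F i)) -> ideal_gen S (\sum_(i <- r | P i) F i).
Proof. by move=> SF; apply: big_ind => //; [apply: ideal_gen0 | apply: ideal_genD]. Qed.

Lemma ideal_gen_ind S (P : A -> Prop) : P 0 -> (forall f g, P f -> P g -> P (f + g)) ->
  (forall c a, S a -> P (c * a)) -> forall f, ideal_gen S f -> P f.
Proof. by move=> P0 PD PS f [k [c [a [Sa ->]]]]; apply: big_ind => // i _; apply: PS. Qed.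

Lemma ideal_pow0 J f : ideal_pow J 0 f.
Proof.
rewrite -[f]mulr1; apply/ideal_genMl/mem_ideal_gen; exists (fun=> 0).
by split; [case | rewrite big_ord0].
Qed.

Lemma ideal_powS J m f g : J f -> ideal_pow J m g -> ideal_pow J m.+1 (f * g).
Proof.
move=> Jf; move: g.
apply: (@ideal_gen_ind _ (fun g => ideal_pow J m.+1 (f * g))) => [|h h'|c _ [a [Ja ->]]].
- by rewrite mulr0; apply: ideal_gen0.
- by rewrite mulrDr; apply: ideal_genD.
rewrite mulrCA; apply/ideal_genMl/mem_ideal_gen.
exists (fun i => if unlift ord0 i is Some j then a j else f); split.
  by move=> i; case: unliftP.
by rewrite big_ord_recl unlift_none; congr (_ * _); apply: eq_bigr => i _; rewrite liftK.
Qed.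

Lemma ideal_pow_leq J m m' f : (m' <= m)%N -> ideal_pow J m f -> ideal_pow J m' f.
Proof.
move=> /subnK <-; elim: (_ - _)%N => // d IH; rewrite addSn => fd; apply: IH.
move: f fd; apply: (@ideal_gen_ind _ (ideal_pow J (d + m')%N)) => [|h h'|c _ [a [Ja ->]]].
- exact: ideal_gen0.
- exact: ideal_genD.
rewrite big_ord_recl mulrA; apply/ideal_genMl/mem_ideal_gen.
by exists (fun i => a (lift ord0 i)).
Qed.

Lemma ideal_pow_exp J m f : J f -> ideal_pow J m (f ^+ m).
Proof.
move=> Jf; elim: m => [|m IH]; first exact: ideal_pow0.
by rewrite exprS; apply: ideal_powS.
Qed.

End Ideals.

Section Localization.
Context (A : idomainType).
Implicit Types (P J : set A) (f s : A).

Lemma local_extension_intro P J s f : s != 0 -> ~ P s -> J (s * f) ->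
  local_extension P J (tofrac f).
Proof.
move=> s0 Ps Jsf; exists 1%N, (fun=> tofrac 1 / tofrac s), (fun=> s * f); split=> //.
  by move=> _; exists 1, s.
by rewrite big_ord1 tofracM tofrac1 mul1r mulKf // tofrac_eq0.
Qed.

(** The product of the denominators of the finitely many summands stays outside [P]. *)
Lemma local_extension_elim P (S : set A) f :
  ~ P 1 -> (forall s s', ~ P s -> ~ P s' -> ~ P (s * s')) -> P 0 ->
  local_extension P (ideal_gen S) (tofrac f) ->
  exists2 s, ~ P s & ideal_gen S (s * f).
Proof.
move=> P1 PM P0 [k [c [a [cP aJ fE]]]].
have [s Ps [b [Jb sb]]] : exists2 s, ~ P s & exists b,
    ideal_gen S b /\ tofrac s * (\sum_(i < k) c i * tofrac (a i)) = tofrac b.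
  elim/big_ind: _ => [|y z [s Ps [b [Jb sb]]] [s' Ps' [b' [Jb' sb']]]|i _].
  - by exists 1 => //; exists 0; rewrite mulr0 tofrac0; split=> //; apply: ideal_gen0.
  - exists (s * s'); first exact: PM.
    exists (s' * b + s * b'); split; first by apply: ideal_genD; apply: ideal_genMl.
    by rewrite tofracD !tofracM -sb -sb'; ring.
  have [c0 [s [Ps ->]]] := cP i; exists s => //; exists (c0 * a i).
  split; first exact: ideal_genMl.
  rewrite tofracM mulrA mulrCA divff ?mulr1 // tofrac_eq0.
  by apply/eqP => s0; apply: Ps; rewrite s0.
exists s => //; suff -> : s * f = b by [].
by apply/eqP; rewrite -tofrac_eq tofracM fE sb.
Qed.

Lemma ideal_pow_symbolic J m f : ideal_pow J m f -> symbolic_power J m f.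
Proof.
move=> Jf P [[[_ P1 _] _] _]; apply: (local_extension_intro (s := 1)).
- exact: oner_neq0.
- by move=> P1'; move/negP: P1; apply; rewrite inE.
- by rewrite mul1r.
Qed.

End Localization.

Lemma mpolyX_eq0 (R : nzRingType) n (m : 'X_{1..n}) : ('X_[m] == 0 :> {mpoly R[n]}) = false.
Proof. by rewrite -msupp_eq0 msuppX. Qed.

Lemma exists_neq_ord N (k : 'I_N.+1) : (0 < N)%N -> exists i, i != k.
Proof.
move=> N0; have [->|k0] := eqVneq k ord0; last by exists ord0; rewrite eq_sym.
by exists ord_max; rewrite -val_eqE /= -lt0n.
Qed.

Section Points.
Context (K : fieldType) (N : nat).
Implicit Types (L : proj_space K N) (f g : {mpoly K[N.+1]}) (X : {fset proj_space K N}).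

Lemma exists_coords L : exists x : 'I_N.+1 * ('I_N.+1 -> K),
  x.2 x.1 = 1 /\ (val L = <[\row_j x.2 j]>%VS).
Proof.
have L1 : \dim (val L) = 1%N := eqP (valP L).
have v0 : vpick (val L) != 0.
  by rewrite vpick0; apply/eqP => L0; move: L1; rewrite L0 dimv0.
have LE : val L = <[vpick (val L)]>%VS.
  apply/esym/eqP; rewrite eqEdim L1 dim_vline v0 andbT.
  by rewrite -memvE memv_pick.
have [i vi] := rV0Pn _ v0; exists (i, fun j => (vpick (val L) 0 i)^-1 * vpick (val L) 0 j).
split; first by rewrite /= mulVf.
have rE : (\row_j ((vpick (val L) 0 i)^-1 * vpick (val L) 0 j)) =
    (vpick (val L) 0 i)^-1 *: vpick (val L) by apply/rowP => j; rewrite !mxE.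
rewrite [RHS](_ : _ = <[vpick (val L)]>%VS) //= rE; apply/eqP.
rewrite eqEdim !dim_vline v0 scaler_eq0 invr_eq0 (negPf vi) (negPf v0) /= andbT.
by rewrite -memvE memvZ // memv_line.
Qed.

Definition coords L := projT1 (cid (exists_coords L)).

Lemma coords_pivot L : (coords L).2 (coords L).1 = 1.
Proof. by rewrite /coords; case: cid => x []. Qed.

Lemma coords_line L : val L = <[\row_j (coords L).2 j]>%VS.
Proof. by rewrite /coords; case: cid => x []. Qed.

(** Parameter 0 substitutes [v_i X_k] for [X_i], that is, restricts [f] to the line. *)
Lemma coef0_dilation (x : 'I_N.+1 * ('I_N.+1 -> K)) f : x.2 x.1 = 1 ->
  (dilation x f)`_0 = \sum_(m <- msupp f) (f@_m * \prod_i x.2 i ^+ m i) *: 'X_(x.1) ^+ mdeg m.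
Proof.
move=> xk; rewrite -horner_coef0 dilationE horner_sum; apply: eq_bigr => m _.
rewrite hornerM hornerC mul_mpolyC -scalerA; congr (_ *: _).
rewrite dilationX horner_prod mdegE -prodrXr -mul_mpolyC rmorph_prod /= -big_split /=.
apply: eq_bigr => i _; rewrite horner_exp rmorphXn /= -exprMn; congr (_ ^+ _).
rewrite /dilation_gen; case: eqVneq => [->|ix]; first by rewrite hornerC xk mpolyC1 mul1r.
by rewrite hornerD hornerM hornerX mulr0 add0r hornerC mul_mpolyC.
Qed.

Lemma ord_ge1_eval L f : ord_ge (coords L) 1 f -> vanishes_at f L.
Proof.
move=> /(_ 0%N isT) f0 v; rewrite coords_line => /vlineP[c ->].
have := congr1 (meval (fun=> c)) f0;
rewrite (coef0_dilation _ (coords_pivot L)) raddf_sum meval0 /= => fc.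
rewrite mevalE -[RHS]fc; apply: eq_bigr => m _.
rewrite mevalZ rmorphXn /= mevalXU -mulrA; congr (_ * _).
rewrite mdegE -prodrXr -big_split; apply: eq_bigr => i _ /=.
by rewrite -exprMn !mxE mulrC.
Qed.

Lemma ord_ge1_homog L f d : f \is d.-homog -> vanishes_at f L -> ord_ge (coords L) 1 f.
Proof.
move=> fd f0 [|//] _; rewrite (coef0_dilation _ (coords_pivot L)).
have /f0 : \row_j (coords L).2 j \in val L by rewrite coords_line memv_line.
rewrite mevalE => e.
transitivity ((\sum_(m <- msupp f) (f@_m * \prod_i (coords L).2 i ^+ m i)) *:
    'X_((coords L).1) ^+ d : {mpoly K[N.+1]}).
  rewrite scaler_suml; apply: eq_big_seq => m mf.
  by rewrite (dhomog_mf fd mf).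
rewrite [X in X *: _](_ : _ = 0) ?scale0r // -[RHS]e; apply: eq_bigr => m _.
by congr (_ * _); apply: eq_bigr => i _; rewrite mxE.
Qed.

Definition ord_ge_on X t : set {mpoly K[N.+1]} :=
  [set f | forall L, L \in X -> ord_ge (coords L) t f].

(** The right side contains the homogeneous components of its elements, and for a form, order one at
    a point means vanishing there. *)
Lemma radical_idealE X : radical_ideal X = ord_ge_on X 1.
Proof.
apply/predeqP => f; split.
  move: f; apply: ideal_gen_ind => [L _|f g fX gX L LX|c a [[d ad] aX] L LX].
  - exact: ord_ge0.
  - by apply: ord_geD; [apply: fX | apply: gX].
  - by apply: ord_geMl; apply: (ord_ge1_homog ad); apply: aX.
move=> fX; rewrite (pihomog_partitionE (leqnn (msize f))); apply: ideal_gen_sum => d _.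
apply: mem_ideal_gen; split; first by exists d; apply: pihomogP.
by move=> L LX; apply/ord_ge1_eval/ord_ge_pihomog/fX.
Qed.

Lemma ideal_pow_ord X t m f : ideal_pow (ord_ge_on X t) m f -> ord_ge_on X (t * m) f.
Proof.
move: f; apply: ideal_gen_ind => [L _|f g fX gX L LX|c _ [a [aX ->]] L LX].
- exact: ord_ge0.
- by apply: ord_geD; [apply: fX | apply: gX].
apply: ord_geMl; elim: m a aX => [|m IH] a aX; first by rewrite muln0.
rewrite big_ord_recl mulnS; apply: ord_geM; first exact: aX.
by apply: IH => i; apply: aX.
Qed.

Lemma ord_ge1_prime (x : 'I_N.+1 * ('I_N.+1 -> K)) f g :
  ~ ord_ge x 1 f -> ~ ord_ge x 1 g -> ~ ord_ge x 1 (f * g).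
Proof. by move=> nf ng fg; apply: nf; apply: (@ord_geM_cancel _ _ x 1 0 f g). Qed.

Lemma not_ord_ge1_1 (x : 'I_N.+1 * ('I_N.+1 -> K)) : ~ ord_ge x 1 1.
Proof. by move=> /(_ 0%N isT) /eqP; rewrite rmorph1 coef1 eqxx oner_eq0. Qed.

Lemma ord_ge1_exp (x : 'I_N.+1 * ('I_N.+1 -> K)) f k :
  ~ ord_ge x 1 f -> ~ ord_ge x 1 (f ^+ k).
Proof.
move=> nf; elim: k => [|k IH]; first exact: not_ord_ge1_1.
by rewrite exprS; apply: ord_ge1_prime.
Qed.

(** If every line coordinate of [L'] of order one vanished on [L], the vector of [L] would be a
    multiple of that of [L']. *)
Lemma separating_line_coord L L' : L != L' ->
  exists i, ord_ge (coords L') 1 (line_coord (coords L') i) /\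
    ~ ord_ge (coords L) 1 (line_coord (coords L') i).
Proof.
move=> LL'; apply: contrapT => no; move/eqP: LL'; apply; apply: val_inj.
have vE : \row_j (coords L).2 j = (coords L).2 (coords L').1 *: \row_j (coords L').2 j.
  apply/rowP => i; rewrite !mxE; have [->|ik] := eqVneq i (coords L').1.
    by rewrite coords_pivot mulr1.
  have /ord_ge1_eval : ord_ge (coords L) 1 (line_coord (coords L') i).
    apply: contrapT => ni; apply: no; exists i; split=> //.
    exact: ord_ge1_line_coord.
  move=> /(_ (\row_j (coords L).2 j)); rewrite coords_line memv_line => /(_ isT).
  rewrite /line_coord (negPf ik) mevalB mevalZ !mevalXU !mxE => /eqP.
  by rewrite subr_eq0 mulrC => /eqP.
apply/eqP; rewrite eqEdim (eqP (valP L)) (eqP (valP L')) leqnn andbT.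
have vL' : \row_j (coords L').2 j \in val L' by rewrite (coords_line L') memv_line.
by rewrite (coords_line L) -memvE vE memvZ.
Qed.

Lemma separating_poly X L : exists s, ~ ord_ge (coords L) 1 s /\
  forall L', L' \in X -> L' != L -> ord_ge (coords L') 1 s.
Proof.
suff [s [sL sX]] : exists s, ~ ord_ge (coords L) 1 s /\
    forall L', L' \in (X : seq _) -> L' != L -> ord_ge (coords L') 1 s by exists s.
elim: (X : seq _) => [|L1 l [s [sL sl]]].
  by exists 1; split=> //; apply: not_ord_ge1_1.
have [->|L1L] := eqVneq L1 L.
  by exists s; split=> // L' /predU1P[->|/sl //]; rewrite eqxx.
have [|i [i1 iL]] := @separating_line_coord L L1; first by rewrite eq_sym.
exists (line_coord (coords L1) i * s); split; first exact: ord_ge1_prime.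
by move=> L' /predU1P[-> _|/sl sl' /sl']; [apply: ord_geMr | apply: ord_geMl].
Qed.

Lemma not_ord_ge1_neq0 (x : 'I_N.+1 * ('I_N.+1 -> K)) f : ~ ord_ge x 1 f -> f != 0.
Proof. by move=> nf; apply/eqP => f0; apply: nf; rewrite f0; apply: ord_ge0. Qed.

(** Multiplied by [s], each line coordinate at [L] other than the pivot vanishes on all of [X]. One
    factor [s] for each of them thus turns order at [L] into membership in an ideal power. *)
Lemma ord_ge_clear X L s f m : (forall L', L' \in X -> L' != L -> ord_ge (coords L') 1 s) ->
  ord_ge (coords L) m f -> exists k, ideal_pow (ord_ge_on X 1) m (s ^+ k * f).
Proof.
move=> sX; move: f; apply: ord_ge_ind => [|f g [a fa] [b gb]|c m' wm'].
- by exists 0%N; rewrite mulr0; apply: ideal_gen0.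
- exists (a + b)%N; have -> : s ^+ (a + b) * (f + g) =
      s ^+ b * (s ^+ a * f) + s ^+ a * (s ^+ b * g).
    by rewrite exprD; ring.
  by apply: ideal_genD; apply: ideal_genMl.
exists (wt (coords L).1 m'); rewrite -mul_mpolyC mulrCA; apply: ideal_genMl.
apply: ideal_pow_leq wm' _.
pose Q w h := forall b g, ideal_pow (ord_ge_on X 1) b g ->
  ideal_pow (ord_ge_on X 1) (w + b) (h * g).
have Q1 h : Q 0%N h by move=> b g gb; apply: ideal_genMl.
have QM a b g h : Q a g -> Q b h -> Q (a + b)%N (g * h).
  by move=> ag bh c' h' /bh /ag; rewrite addnA mulrA.
suff : Q (wt (coords L).1 m') (s ^+ wt (coords L).1 m' * line_monomial (coords L) m').
  by move=> /(_ 0%N 1 (ideal_pow0 _ _)); rewrite addn0 mulr1.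
rewrite /wt big_mkcond -prodrXr -big_split; elim/big_ind2: _ => // [a g b h|i _]; first exact: QM.
have [_|ik] := eqVneq i (coords L).1; first exact: Q1.
rewrite /= -exprMn; elim: (m' i) => [|k IH]; first exact: Q1.
rewrite exprS -add1n; apply: QM IH => b g gb; rewrite add1n; apply: ideal_powS gb.
move=> L' L'X; have [->|L'L] := eqVneq L' L; last exact/ord_geMr/sX.
by apply: ord_geMl; apply: ord_ge1_line_coord.
Qed.

(* The ideal [P] of [L] is the annihilator of [s ^+ t * y ^+ t.-1], where [s]
   vanishes on the other points but not at [L], and [y] has order one at [L]. *)
Lemma symbolic_power_ord X t m f : (0 < N)%N -> (0 < t)%N ->
  symbolic_power (ord_ge_on X t) m f -> ord_ge_on X (t * m) f.
Proof.
move=> N0 t0 fm L LX; pose P : set {mpoly K[N.+1]} := ord_ge (coords L) 1.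
have P0 : P 0 by apply: ord_ge0.
have P1 : ~ P 1 := @not_ord_ge1_1 _.
have [s [sL sX]] := separating_poly X L.
have [i ik] := exists_neq_ord (coords L).1 N0.
have y1 : ord_ge (coords L) 1 (line_coord (coords L) i) by apply: ord_ge1_line_coord.
have yt : ~ ord_ge (coords L) t (line_coord (coords L) i ^+ t.-1).
  move=> /(_ t.-1); rewrite prednK // leqnn => /(_ isT) /eqP.
  rewrite rmorphXn /= dilation_line_coord (negPf ik) exprMn -rmorphXn coefCM coefXn eqxx mulr1.
  by rewrite mpolyXn mpolyX_eq0.
have PA : Ass (ord_ge_on X t) P.
  split; last first.
    exists (s ^+ t * line_coord (coords L) i ^+ t.-1); apply/predeqP => h; split=> [h1 L' L'X|].
      have [->|L'L] := eqVneq L' L; last first.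
        by apply/ord_geMl/ord_geMr; rewrite -[t in ord_ge _ t]mul1n; apply/ord_ge_exp/sX.
      rewrite mulrCA; apply: ord_geMl.
      rewrite -[t in ord_ge _ t](prednK t0) -[t.-1.+1]add1n; apply: ord_geM => //.
      by have := @ord_ge_exp _ _ _ _ t.-1 _ y1; rewrite mul1n.
    (* Cancelling the last factor, of order exactly [t.-1], leaves order one for [h * s ^+ t]; as
       [s] does not vanish at [L], [h] does. *)
    move=> /(_ L LX); rewrite -[t in ord_ge _ t](prednK t0) -[t.-1.+1]add1n mulrA => hX.
    suff : ord_ge (coords L) 1 (h * s ^+ t).
      by apply: contraPP => nh; apply: ord_ge1_prime => //; apply: ord_ge1_exp.
    by apply: (ord_geM_cancel hX); rewrite prednK.
  split; first split.
  - by rewrite inE.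
  - by apply/negP; rewrite inE.
  - move=> a u v; rewrite !inE => u1 v1.
    by apply: ord_geD v1; apply: ord_geMl.
  - move=> u v; rewrite inE => uv; apply/orP.
    have [u1|u1] := pselect (P u); first by left; rewrite inE.
    have [v1|v1] := pselect (P v); first by right; rewrite inE.
    by have := ord_ge1_prime u1 v1 uv.
have [s' s'L /ideal_pow_ord] := local_extension_elim P1 (@ord_ge1_prime _) P0 (fm P PA).
move=> /(_ L LX); rewrite (mulrC s') => s'f.
by apply: (ord_geM_cancel (b := 0) _ s'L); rewrite addn0.
Qed.

(** For an associated prime [J_1 : g], there is a point [L] of [X] where [g] has order zero. The
    powers of a polynomial [s] separating [L] from the other points then lie outside the prime and
    serve as denominators. *)
Lemma ord_symbolic_power X m f : ord_ge_on X m f -> symbolic_power (ord_ge_on X 1) m f.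
Proof.
move=> fX P [[[_ P1 _] _] [g PE]].
have : ~ ord_ge_on X 1 g.
  move=> g1; move/negP: P1; apply; rewrite inE PE /=.
  by rewrite mul1r.
move=> /existsNP[L /not_implyP[LX gL]]; have [s [sL sX]] := separating_poly X L.
have [k sf] := ord_ge_clear sX (fX L LX); apply: (local_extension_intro (s := s ^+ k)) sf.
- exact/expf_neq0/(not_ord_ge1_neq0 sL).
- by rewrite PE => /(_ L LX); apply: ord_ge1_prime => //; apply: ord_ge1_exp.
Qed.

Lemma symbolic_power_radical X t : (0 < N)%N ->
  symbolic_power (radical_ideal X) t = ord_ge_on X t.
Proof.
move=> N0; rewrite radical_idealE; apply/predeqP => f; split.
  by move=> /(symbolic_power_ord N0 (ltn0Sn 0)); rewrite mul1n.
exact: ord_symbolic_power.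
Qed.

(** A product of linear forms, one through each point. It ensures that the minima defining [alpha]
    are attained, so that the default value of [alpha] does not interfere. *)
Lemma exists_vanishing_form X : (0 < N)%N ->
  exists d f, [/\ f != 0, f \is d.-homog & ord_ge_on X 1 f].
Proof.
move=> N0; suff [d [f [f0 fd fX]]] : exists d f, [/\ f != 0, f \is d.-homog &
    forall L, L \in (X : seq _) -> ord_ge (coords L) 1 f] by exists d, f.
elim: (X : seq _) => [|L l [d [f [f0 fd fl]]]].
  by exists 0%N, 1; split=> //; [exact: oner_neq0 | exact: dhomog1].
have [i ik] := exists_neq_ord (coords L).1 N0.
have y1 : ord_ge (coords L) 1 (line_coord (coords L) i) by apply: ord_ge1_line_coord.
exists (1 + d)%N, (line_coord (coords L) i * f); split.
- rewrite mulf_neq0 // -(dilation_eq0 (coords L)) dilation_line_coord (negPf ik).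
  by rewrite mulf_neq0 ?polyX_eq0 // polyC_eq0 mpolyX_eq0.
- apply: dhomogM => //; rewrite /line_coord (negPf ik).
  by apply: rpredB; [|apply: rpredZ]; rewrite dhomogX; apply/eqP/mdeg1.
- by move=> L' /predU1P[->|/fl fL']; [apply: ord_geMr | apply: ord_geMl].
Qed.

End Points.

(** * Least degrees and the final inequality *)

Lemma alphaP (K : fieldType) n (J : set {mpoly K[n]}) d : has_form_of_degree J d ->
  has_form_of_degree J (alpha J) /\ forall e, has_form_of_degree J e -> (alpha J <= e)%N.
Proof.
move=> Jd; suff ex : exists d, has_form_of_degree J d /\
    forall e, has_form_of_degree J e -> (d <= e)%N by exact: (xgetPex 0%N ex).
have exb : exists d, `[< has_form_of_degree J d >] by exists d; apply/asboolP.
case: (ex_minnP exb) => a /asboolP Ja mina; exists a; split=> // e Je.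
by apply: mina; apply/asboolP.
Qed.

Lemma symbolic_degree_arith N t a d m : (0 < N)%N -> (N - 1 <= t)%N -> (0 < t)%N -> (0 < a)%N ->
  ((a + (1 < N)%N) * (t * m) <= d * (t + N).-1)%N -> ((a + N - 1) * m <= d * N)%N.
Proof.
case: N => [//|[|n]] _ tN t0 a0 /= h.
  rewrite addnK muln1 -(leq_pmul2l t0) mulnCA (mulnC t d).
  by move: h; rewrite addn0 addn1.
have {}h : ((a + 1) * (t * m) <= d * (t + n.+1))%N by move: h; rewrite (addnS t).
(* Here [N = n.+2]. Both sides agree at [a = 1], [t = N - 1], and from there the right side grows at
   least as fast in [a] and in [t]. *)
have key : ((a + n.+1) * (t + n.+1) <= (a + 1) * t * n.+2)%N.
  case: a a0 {h} => // a _.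
  have [u ->] : exists u, t = (n + 1 + u)%N by exists (t - (n + 1))%N; lia.
  nia.
have tn : (0 < t + n.+1)%N by lia.
rewrite -(leq_pmul2r tn).
have := leq_mul key (leqnn m); have := leq_mul h (leqnn n.+2).
have -> : (a + n.+2 - 1 = a + n.+1)%N by lia.
by lia.
Qed.

Local Open Scope fset_scope.

(* [R[i]] is the field of complex numbers over the real numbers [R]. *)
Theorem proposition3p10 (R : realType) (N : nat) (hN : (1 <= N)%N)
    (X : {fset proj_space R[i] N}) (hX : X != fset0)
    (I : set {mpoly R[i][N.+1]}) (hI : I = radical_ideal X)
    (t : nat) (ht0 : (0 < t)%N) (ht : (N - 1 <= t)%N)
    (m : nat) (hm : (1 <= m)%N) :
  (alpha (symbolic_power (symbolic_power I t) m))%:R / m%:R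
    >= ((alpha (symbolic_power I t))%:R + N%:R - 1) / N%:R :> rat.
Proof.
rewrite {}hI symbolic_power_radical //.
set J := ord_ge_on X t; set J' := symbolic_power J m.
have [e [f [f0 fe fX]]] := exists_vanishing_form X hN.
have Jf : J (f ^+ t) by move=> L LX; rewrite -[t in ord_ge _ t]mul1n; apply/ord_ge_exp/fX.
have [|[F [F0 Fd FJ]] alpha_min] := @alphaP _ _ J (e * t).
  by exists (f ^+ t); split=> //; [apply: expf_neq0 | apply: dhomogMn].
have [|[F' [F'0 F'd F'J]] _] := @alphaP _ _ J' (e * t * m).
  exists ((f ^+ t) ^+ m); split; [by rewrite !expf_neq0 | by apply/dhomogMn/dhomogMn |].
  exact/ideal_pow_symbolic/ideal_pow_exp.
have [L0 L0X] : exists L0, L0 \in X by apply/fset0Pn.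
(* A nonzero constant has order zero at a point of [X]; this uses that [X] is nonempty. *)
have alpha_gt0 : (0 < alpha J)%N.
  rewrite lt0n; apply/eqP => a0; have Fc : F = (F@_0)%:MP.
    apply: msize1_polyC; have := dhomog_uniq F0 (dhomog_msize Fd) Fd.
    by rewrite a0; case: (mmeasure _ F) => [|[]].
  have := FJ L0 L0X 0%N ht0; rewrite Fc -[_%:MP]mulr1 mul_mpolyC dilationZ rmorph1 mulr1 coefC eqxx.
  by move=> /eqP; rewrite mpolyC_eq0 => /eqP c0; move/eqP: F0; apply; rewrite Fc c0 mpolyC0.
pose Y (i : 'I_(size X)) := coords (tnth (in_tuple X) i).
have YX s g : (forall i, ord_ge (Y i) s g) <-> ord_ge_on X s g.
  split=> [gY L LX|gX i]; last exact/gX/mem_tnth.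
  by have /tnthP[i ->] : L \in in_tuple X by []; apply: gY.
(* The minimality of [alpha J] among forms extends to all polynomials through their homogeneous
   components. *)
have minX g : g != 0 -> (forall i, ord_ge (Y i) t g) -> (alpha J < msize g)%N.
  move=> g0 /YX gX; rewrite ltnNge; apply/negP => gs; move/eqP: g0; apply.
  rewrite (pihomog_partitionE gs); apply: big1 => i _; apply/eqP/negPn/negP => gi.
  have := alpha_min i; rewrite leqNgt ltn_ord => /(_ _)/negP; apply=> //.
  exists (pihomog mdeg i g); split=> //; first exact: pihomogP.
  by move=> L LX; apply/ord_ge_pihomog/gX.
have C0 : [pchar R[i]] =i pred0 := pchar_num _.
have := degree_lower_bound C0 hN ht0 alpha_gt0 _ minX F'0 (s := (t * m)%N).
rewrite muln_gt0 ht0 hm => /(_ isT ((YX _ _).2 (symbolic_power_ord hN ht0 F'J))).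
have -> : (msize F').-1 = alpha J'.
  by apply: (dhomog_uniq F'0 (dhomog_msize F'd) F'd).
move=> /(symbolic_degree_arith hN ht ht0 alpha_gt0) le.
rewrite ler_pdivrMr ?ltr0n // mulrAC ler_pdivlMr ?ltr0n //.
rewrite -natrD -(natrB _ (n := 1)) ?addn_gt0 ?alpha_gt0 //.
by rewrite -!natrM ler_nat.
Qed.
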